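(* Let $G$ be a finitely generated group of exponential growth and let $H\neq\{1\}$ be a finite group. Let $d$ be a word metric (with respect to a finite generating set) on the wreath product $H\wr G$. Then: (1) all asymptotic cones of $(H\wr G,\log(1+d))$ are ultrametric; (2) $\operatorname{asdim}_{AN}(H\wr G,\log(1+d))=\infty$.
   Context: $H\wr G=\left(\bigoplus_{g\in G}H\right)\rtimes G$, with $G$ acting by shifting coordinates. $\log(1+d)$ denotes the metric $(x,y)\mapsto\log(1+d(x,y))$. Asymptotic cones: for a non-principal ultrafilter $\omega$ on $\mathbb{N}$, a sequence $c$ and positive reals $d_n$ with $\lim_\omega d_n=\infty$, $\operatorname{Cone}_\omega(X,c,d)$ is the set of sequences $(x_n)$ with $\lim_\omega \rho(x_n,c_n)/d_n<\infty$ with pseudometric $\lim_\omega\rho(x_n,y_n)/d_n$, modulo distance zero ($\rho$ the metric of $X$). Ultrametric: $\rho(x,y)\le\max\{\rho(x,z),\rho(y,z)\}$. $\operatorname{asdim}_{AN}(X)$ is the least $n$ such that for some constants $C>0,k$ and every $s>0$ there is a cover $\{\mathcal U_0,\dots,\mathcal U_n\}$ of $X$ whose members have $s$-scale connected components (classes of ''joined by a chain $x_0,\dots,x_m$ inside the set with consecutive distances $<s$'') of diameter $\le Cs+k$; $\infty$ if no such $n$. *)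

(* Defs.v *)
From Stdlib Require Import Reals List.
Open Scope R_scope.

Record Group := {
  gcar :> Type;
  gmul : gcar -> gcar -> gcar;
  gone : gcar;
  ginv : gcar -> gcar;
  gassoc : forall x y z, gmul x (gmul y z) = gmul (gmul x y) z;
  gmul1l : forall x, gmul gone x = x;
  gmul1r : forall x, gmul x gone = x;
  gmulVl : forall x, gmul (ginv x) x = gone;
  gmulVr : forall x, gmul x (ginv x) = gone
}.

Inductive cay_path {X : Type} (mul : X -> X -> X) (Sg : list X) : nat -> X -> X -> Prop :=
| cp_nil x : cay_path mul Sg 0 x x
| cp_step n x y z s : cay_path mul Sg n x y -> In s Sg ->
    (z = mul y s \/ y = mul z s) -> cay_path mul Sg (S n) x z.

(** d is the word metric w.r.t. the finite generating set S
    (this also forces S to generate: any two points are joined). *)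
Definition is_word_metric {X : Type} (mul : X -> X -> X) (S : list X)
  (d : X -> X -> R) : Prop :=
  forall x y, exists n, cay_path mul S n x y /\
    (forall m, cay_path mul S m x y -> (n <= m)%nat) /\ d x y = INR n.

Definition in_ball (G : Group) (T : list G) (n : nat) (x : G) : Prop :=
  exists m, (m <= n)%nat /\ cay_path (gmul G) T m (gone G) x.

Definition generates (G : Group) (T : list G) : Prop :=
  forall x : G, exists n, cay_path (gmul G) T n (gone G) x.

(** Exponential growth: the ball-counting function b(n) satisfies b(n) >= c^n
    for some c > 1 (equivalently lim b(n)^(1/n) > 1, by submultiplicativity). *)
Definition exp_growth (G : Group) (T : list G) : Prop :=
  exists c, 1 < c /\ forall n : nat, exists l : list G,
    NoDup l /\ (forall x, In x l -> in_ball G T n x) /\ c ^ n <= INR (length l).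

Definition fsupp (G H : Group) (f : G -> H) : Prop :=
  exists l : list G, forall x, ~ In x l -> f x = gone H.

Definition fsfun (G H : Group) := { f : G -> H | fsupp G H f }.

Lemma fsupp_mul (G H : Group) (f f' : G -> H) (g : G) :
  fsupp G H f -> fsupp G H f' ->
  fsupp G H (fun x => gmul H (f x) (f' (gmul G (ginv G g) x))).
Proof.
  intros [l Hl] [l' Hl']. exists (l ++ map (gmul G g) l'). intros x Hx.
  rewrite in_app_iff in Hx.
  rewrite Hl, Hl'. apply gmul1l.
  - intro Hin. apply Hx. right. apply in_map_iff.
    exists (gmul G (ginv G g) x). split; [|exact Hin].
    rewrite gassoc, gmulVr, gmul1l. reflexivity.
  - intro Hin. apply Hx. left. exact Hin.
Qed.

Definition wreath (H G : Group) : Type := (fsfun G H * G)%type.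

Definition wmul (H G : Group) (a b : wreath H G) : wreath H G :=
  let (f, g) := a in let (f', g') := b in
  (exist _ (fun x => gmul H (proj1_sig f x) (proj1_sig f' (gmul G (ginv G g) x)))
         (fsupp_mul G H _ _ g (proj2_sig f) (proj2_sig f')),
   gmul G g g').

Definition log1p {X : Type} (d : X -> X -> R) : X -> X -> R :=
  fun x y => ln (1 + d x y).

Definition is_ultrafilter (U : (nat -> Prop) -> Prop) : Prop :=
  U (fun _ => True) /\ ~ U (fun _ => False) /\
  (forall A B : nat -> Prop, U A -> (forall n, A n -> B n) -> U B) /\
  (forall A B : nat -> Prop, U A -> U B -> U (fun n => A n /\ B n)) /\
  (forall A : nat -> Prop, U A \/ U (fun n => ~ A n)).

Definition nonprincipal (U : (nat -> Prop) -> Prop) : Prop :=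
  forall k : nat, ~ U (fun n => n = k).

Definition ulim (U : (nat -> Prop) -> Prop) (a : nat -> R) (L : R) : Prop :=
  forall eps, 0 < eps -> U (fun n => Rabs (a n - L) < eps).

Definition ulim_infty (U : (nat -> Prop) -> Prop) (a : nat -> R) : Prop :=
  forall M, U (fun n => M < a n).

(** lim_omega a < infinity (for nonnegative a) *)
Definition ubounded (U : (nat -> Prop) -> Prop) (a : nat -> R) : Prop :=
  exists M, U (fun n => a n <= M).

Definition in_cone {X : Type} (rho : X -> X -> R) (U : (nat -> Prop) -> Prop)
  (c : nat -> X) (dn : nat -> R) (x : nat -> X) : Prop :=
  ubounded U (fun n => rho (x n) (c n) / dn n).

(** All asymptotic cones are ultrametric (the quotient by distance zero does not
    affect the ultrametric inequality, so we state it on representatives). *)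
Definition all_cones_ultrametric {X : Type} (rho : X -> X -> R) : Prop :=
  forall U, is_ultrafilter U -> nonprincipal U ->
  forall (c : nat -> X) (dn : nat -> R),
    (forall n, 0 < dn n) -> ulim_infty U dn ->
  forall x y z : nat -> X,
    in_cone rho U c dn x -> in_cone rho U c dn y -> in_cone rho U c dn z ->
  forall Lxy Lxz Lyz : R,
    ulim U (fun n => rho (x n) (y n) / dn n) Lxy ->
    ulim U (fun n => rho (x n) (z n) / dn n) Lxz ->
    ulim U (fun n => rho (y n) (z n) / dn n) Lyz ->
    Lxy <= Rmax Lxz Lyz.

Inductive schain {X : Type} (rho : X -> X -> R) (A : X -> Prop) (s : R) : X -> X -> Prop :=
| sc_refl x : A x -> schain rho A s x x
| sc_step x y z : schain rho A s x y -> A z -> rho y z < s -> schain rho A s x z.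

Definition asdimAN_le {X : Type} (rho : X -> X -> R) (n : nat) : Prop :=
  exists C k : R, 0 < C /\
    forall s, 0 < s ->
      exists Us : nat -> X -> Prop,
        (forall x, exists i, (i <= n)%nat /\ Us i x) /\
        (forall i, (i <= n)%nat -> forall x y,
            schain rho (Us i) s x y -> rho x y <= C * s + k).

Definition asdimAN_infinite {X : Type} (rho : X -> X -> R) : Prop :=
  forall n : nat, ~ asdimAN_le rho n.

(* Main.v *)
Require Import Defs.
From Stdlib Require Import Reals List ZArith Lra Lia.
From Stdlib Require Import Classical ClassicalEpsilon FunctionalExtensionality.
From Stdlib Require Import PropExtensionality ProofIrrelevance.
From Stdlib Require FinFun.
From mathcomp Require Import ssreflect ssrfun ssrbool eqtype ssrnat seq.
From mathcomp Require Import fintype finfun bigop.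
Open Scope R_scope.

(** The cones are ultrametric because ln (1 + a + b) <= ln 2 + max (ln (1 + a))
    (ln (1 + b)) and the constant ln 2 vanishes after rescaling.

    For the dimension, let p_1, ..., p_M be the elements of the ball of radius r
    in G, so M >= c ^ r, and let h <> 1 in H.  Switching lamps between 1 and h
    at the p_i, with the cursor at 1, embeds the Hamming cube {0,1}^M in the
    wreath product.  Flipping one lamp costs O(r), whereas the word metric
    dominates a multiple of the Hamming metric.  If log (1 + d) had
    Assouad-Nagata dimension at most n, the cube would be covered by n + 1 sets
    such that points of one set at Hamming distance 2 lie in one component, and
    components have Hamming diameter D polynomial in r.  A double count of the
    edges of the cube shows M <= D + (n + 1)(D + 1), which fails for large r. *)

(** * Colourings of the Hamming cube *)

Section Cube.

Variable M : nat.

Definition flip (v : {ffun 'I_M -> bool}) (i : 'I_M) : {ffun 'I_M -> bool} :=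
  [ffun j => (j == i) (+) v j].

Definition hamming (v w : {ffun 'I_M -> bool}) : nat :=
  (\sum_(i < M) (v i != w i))%N.

Lemma flipK (i : 'I_M) : involutive (flip^~ i).
Proof. by move=> v; apply/ffunP=> j; rewrite !ffunE addbA addbb. Qed.

Lemma hamming_flip v i w : (hamming v w <= (hamming (flip v i) w).+1)%N.
Proof.
rewrite /hamming (bigD1 i) //= [X in (_ <= X.+1)%N](bigD1 i) //=.
rewrite -addSn leq_add //; first by case: (_ != _).
by apply: eq_leq; apply: eq_bigr => j /negPf ji; rewrite ffunE ji.
Qed.

(* Count the pairs (v, i) according to whether v or flip v i is closer to the
   centre attached to flip v i: a vertex x = flip v i has at most D neighbours
   closer to its centre, while for fixed v each colour contributes a single
   centre, at distance at most D + 1 from v. *)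
Lemma cube_colouring_bound (n D : nat) (col : {ffun 'I_M -> bool} -> 'I_n.+1)
    (ctr : {ffun 'I_M -> bool} -> {ffun 'I_M -> bool}) :
  (forall v, hamming v (ctr v) <= D)%N ->
  (forall v i j, col (flip v i) = col (flip v j) ->
     ctr (flip v i) = ctr (flip v j)) ->
  (M <= D + n.+1 * D.+1)%N.
Proof.
move=> ctrD ctr_col; pose V : finType := {ffun 'I_M -> bool}.
have V_gt0 : (0 < #|V|)%N by apply/card_gt0P; exists [ffun=> false].
rewrite -(leq_pmul2l V_gt0).
have -> : (#|V| * M =
    \sum_(v : V) \sum_(i < M) (v i == ctr (flip v i) i) +
    \sum_(v : V) \sum_(i < M) (v i != ctr (flip v i) i))%N.
  rewrite -big_split /= -sum_nat_const; apply: eq_bigr => v _.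
  rewrite -big_split /= -[LHS]card_ord -sum1_card; apply: eq_bigr => i _.
  by case: (_ == _).
rewrite mulnDr leq_add //.
  (* For fixed [i], replacing [v] by [flip v i] makes the first sum count the coordinates where [v]
     differs from its own centre. *)
  rewrite exchange_big /=.
  under eq_bigr => i _ do rewrite (reindex_inj (inv_inj (flipK i))).
  rewrite exchange_big /= -sum_nat_const leq_sum // => v _.
  apply: leq_trans (ctrD v); rewrite leq_sum // => i _.
  by rewrite flipK ffunE eqxx; case: (v i); case: (ctr v i).
rewrite -sum_nat_const leq_sum // => v _.
rewrite (partition_big (fun i => col (flip v i)) predT) //=.
rewrite -[X in (_ <= X * _)%N]card_ord -sum_nat_const leq_sum // => c _.
have [i0 /eqP ci0 | no_i] := pickP (fun i => col (flip v i) == c); last first.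
  by rewrite big_pred0.
apply: (@leq_trans (hamming v (ctr (flip v i0)))); last first.
  by apply: leq_trans (hamming_flip v i0 _) _; rewrite ltnS.
rewrite /hamming big_mkcond leq_sum // => i _.
by case: eqP => // ci; rewrite (ctr_col v i i0) // ci.
Qed.

End Cube.

Arguments flip {M}.
Arguments hamming {M}.

Lemma NoDup_uniq (A : eqType) (s : seq A) : uniq s -> NoDup s.
Proof.
elim: s => [|a s IH] /=; first by constructor.
case/andP=> /negP as_ us; constructor; last exact: IH.
by move=> ins; apply: as_; elim: s ins {IH us} => //= b s IH [->|/IH bs];
  rewrite inE ?eqxx // bs orbT.
Qed.

Lemma In_mem (A : eqType) (s : seq A) (x : A) : In x s -> x \in s.
Proof. by elim: s => //= b s IH [->|/IH xs]; rewrite inE ?eqxx // xs orbT. Qed.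

Lemma hamming_le_cover (X : Type) (M : nat) (p : 'I_M -> X) (l : list X)
    (v w : {ffun 'I_M -> bool}) :
  injective p -> (forall i, v i <> w i -> In (p i) l) ->
  (hamming v w <= length l)%coq_nat.
Proof.
move=> p_inj vw.
have -> : hamming v w = length (List.map p (enum [pred i | v i != w i])).
  rewrite length_map -[length _]/(size _) -cardE -sum1_card big_mkcond.
  by apply: eq_bigr => i _; rewrite inE; case: (_ != _).
apply: NoDup_incl_length.
  by apply: FinFun.Injective_map_NoDup => //; apply/NoDup_uniq/enum_uniq.
move=> _ /in_map_iff[i [<- /In_mem]]; rewrite mem_enum inE => /eqP.
exact: vw.
Qed.

(** * Word metrics *)

Section Paths.

Variables (X : Type) (mul : X -> X -> X) (gens : list X).

Lemma cay_path_app m n x y z :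
  cay_path mul gens m x y -> cay_path mul gens n y z ->
  cay_path mul gens (n + m) x z.
Proof.
move=> xy yz; elim: yz xy => [a|k a b c s _ IH Hs bc] xa //.
by apply: (cp_step _ _ _ _ b _ s) => //; apply: IH.
Qed.

Lemma cay_path_sym n x y : cay_path mul gens n x y -> cay_path mul gens n y x.
Proof.
elim=> [a|k a b c s _ IH Hs bc]; first by constructor.
have cb : cay_path mul gens 1 c b.
  by apply: (cp_step _ _ _ _ c _ s) => //; [constructor | tauto].
by have := cay_path_app _ _ _ _ _ cb IH; rewrite addn1.
Qed.

Hypothesis mulA : forall x y z, mul x (mul y z) = mul (mul x y) z.

(** Generators multiply on the right, so associativity alone lets left multiplication preserve
    edges. This suits [wmul], a bare operation not packaged as a [Group]. *)
Lemma cay_path_mull a n x y :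
  cay_path mul gens n x y -> cay_path mul gens n (mul a x) (mul a y).
Proof.
elim=> [b|k b c e s _ IH Hs bc]; first by constructor.
apply: (cp_step _ _ _ _ (mul a c) _ s) => //.
by case: bc => ->; rewrite mulA; [left | right].
Qed.

Variable d : X -> X -> R.
Hypothesis dP : is_word_metric mul gens d.

Lemma dist_le n x y : cay_path mul gens n x y -> d x y <= INR n.
Proof.
by move=> xy; have [m [_ [min ->]]] := dP x y; apply: le_INR; apply: min.
Qed.

Lemma dist_path x y : exists2 n, cay_path mul gens n x y & d x y = INR n.
Proof. by have [n [? [_ ?]]] := dP x y; exists n. Qed.

Lemma dist_ge0 x y : 0 <= d x y.
Proof. by have [n _ ->] := dist_path x y; apply: pos_INR. Qed.

Lemma dist_refl x : d x x = 0.
Proof.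
apply: Rle_antisym; last exact: dist_ge0.
by apply: (dist_le 0); constructor.
Qed.

Lemma dist_sym x y : d x y = d y x.
Proof.
have le a b : d a b <= d b a.
  by have [n /cay_path_sym /dist_le ? ->] := dist_path b a.
exact: Rle_antisym.
Qed.

Lemma dist_triangle y x z : d x z <= d x y + d y z.
Proof.
have [m xy ->] := dist_path x y; have [n yz ->] := dist_path y z.
by rewrite Rplus_comm -plus_INR; apply: dist_le; apply: cay_path_app yz.
Qed.

Lemma dist_mull a x y : d (mul a x) (mul a y) <= d x y.
Proof.
by have [n xy ->] := dist_path x y; apply: dist_le; apply: cay_path_mull.
Qed.

End Paths.

(** * Logarithms of metrics *)

Lemma ln_le_mono x y : 0 < x -> x <= y -> ln x <= ln y.
Proof. by move=> x0 [/ln_increasing|->]; auto with real. Qed.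

(** This is the logarithm of 1 + a + b <= 2 (1 + max (a, b)). *)
Lemma ln1p_add_le a b : 0 <= a -> 0 <= b ->
  ln (1 + (a + b)) <= ln 2 + Rmax (ln (1 + a)) (ln (1 + b)).
Proof.
move=> a0 b0.
have le c : 0 <= c -> a <= c -> b <= c -> ln (1 + (a + b)) <= ln 2 + ln (1 + c).
  by move=> c0 ac bc; rewrite -ln_mult; [apply: ln_le_mono; lra | lra | lra].
have := Rmax_l (ln (1 + a)) (ln (1 + b)).
have := Rmax_r (ln (1 + a)) (ln (1 + b)).
by have [ab|ba] := Rle_dec a b; [have := le b | have := le a]; lra.
Qed.

Lemma log1p_cones_ultrametric (X : Type) (d : X -> X -> R) :
  (forall x y, 0 <= d x y) -> (forall x y z, d x y <= d x z + d y z) ->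
  all_cones_ultrametric (log1p d).
Proof.
move=> d0 dtri U [_ [UF [Usub [Uand _]]]] _ c dn dn0 dnoo x y z _ _ _.
move=> Lxy Lxz Lyz lxy lxz lyz; apply: Rnot_lt_le => lt.
(* A quarter of the gap: the errors in [Lxy] and in the maximum, together with [ln 2 / dn n], cost
   less than 3 [e]. One index where all four estimates hold is contradictory, so their intersection,
   a member of [U], would be empty. *)
set e := (Lxy - Rmax Lxz Lyz) / 4.
have e0 : 0 < e by rewrite /e; lra.
apply: UF.
apply: Usub (Uand _ _ (Uand _ _ (lxy e e0) (lxz e e0))
                      (Uand _ _ (lyz e e0) (dnoo (ln 2 / e)))) _.
move=> n [[/Rabs_def2 hxy /Rabs_def2 hxz] [/Rabs_def2 hyz hd]].
have {}hd : ln 2 / dn n < e.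
  apply: (Rmult_lt_reg_r (dn n)) => //.
  rewrite /Rdiv Rmult_assoc Rinv_l; last by have := dn0 n; lra.
  have := Rmult_lt_compat_r e _ _ e0 hd.
  by rewrite /Rdiv Rmult_assoc Rinv_l; lra.
have key : log1p d (x n) (y n) / dn n <= ln 2 / dn n +
    Rmax (log1p d (x n) (z n) / dn n) (log1p d (y n) (z n) / dn n).
  have i0 : 0 < / dn n by apply: Rinv_0_lt_compat.
  rewrite /Rdiv !(Rmult_comm _ (/ dn n)) RmaxRmult; last by lra.
  rewrite -Rmult_plus_distr_l; apply: Rmult_le_compat_l; first lra.
  apply: Rle_trans (ln1p_add_le _ _ (d0 _ _) (d0 _ _)).
  apply: ln_le_mono; first by have := d0 (x n) (y n); lra.
  by have := dtri (x n) (y n) (z n); lra.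
have max_le : Rmax (log1p d (x n) (z n) / dn n) (log1p d (y n) (z n) / dn n) <=
    Rmax Lxz Lyz + e.
  have := Rmax_l Lxz Lyz; have := Rmax_r Lxz Lyz.
  by move=> ? ?; apply: Rmax_lub; lra.
rewrite /e in hd hxy max_le; lra.
Qed.

Lemma ln_lt_id x : 0 < x -> ln x < x.
Proof.
by move=> x0; have := exp_ineq1_le (ln x); rewrite exp_ln //; lra.
Qed.

(** Take r = j^2 and e = a + b. For j >= 1 the logarithm is at most ln ((e j)^2) <= 2 e j, linear in
    j, while r l is quadratic. *)
Lemma linear_dominates_log (l C K a b : R) :
  0 < l -> 0 < C -> 0 <= a -> 1 <= b ->
  exists r : nat, C * ln (a * INR r + b) + K < INR r * l.
Proof.
move=> l0 C0 a0 b1; set e := a + b.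
have [j hj] := INR_unbounded (1 + (2 * C * e + Rabs K) / l).
exists (j * j)%coq_nat; rewrite mult_INR.
have K0 := Rabs_pos K; have KK := Rle_abs K.
have e1 : 1 <= e by rewrite /e; lra.
have Ce : 0 < C * e by apply: Rmult_lt_0_compat; lra.
have q0 : 0 <= (2 * C * e + Rabs K) / l.
  by apply: Rmult_le_pos; [lra | apply/Rlt_le/Rinv_0_lt_compat].
have jl : 2 * C * e + Rabs K < INR j * l.
  have lt : (2 * C * e + Rabs K) / l < INR j by lra.
  have := Rmult_lt_compat_r l _ _ l0 lt.
  by rewrite /Rdiv Rmult_assoc Rinv_l; lra.
set t := INR j in hj jl *.
have lnle : ln (a * (t * t) + b) <= 2 * (e * t).
  have et0 : 0 < e * t by apply: Rmult_lt_0_compat; lra.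
  have -> : 2 * (e * t) = e * t + e * t by ring.
  apply: (Rle_trans _ (ln ((e * t) * (e * t)))).
    have t1 : 1 <= t * t by nra.
    have at0 : 0 <= a * (t * t) by apply: Rmult_le_pos; lra.
    apply: ln_le_mono; first lra.
    apply: (Rle_trans _ (e * (t * t))).
      have := Rmult_le_compat_l b _ _ ltac:(lra) t1; rewrite /e; lra.
    have -> : e * t * (e * t) = e * (e * (t * t)) by ring.
    have et : 0 <= e * (t * t) by apply: Rmult_le_pos; lra.
    have := Rmult_le_compat_r _ _ _ et e1; lra.
  by rewrite ln_mult //; have := ln_lt_id _ et0; lra.
have := Rmult_le_compat_l C _ _ (Rlt_le _ _ C0) lnle.
have : (2 * C * e + Rabs K) * t < t * l * t by apply: Rmult_lt_compat_r; lra.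
have : Rabs K * 1 <= Rabs K * t by apply: Rmult_le_compat_l; lra.
nra.
Qed.

(** * Chains *)

Section Chains.

Variables (X : Type) (rho : X -> X -> R) (A : X -> Prop) (s : R).

Lemma schain_trans x y z :
  schain rho A s x y -> schain rho A s y z -> schain rho A s x z.
Proof.
move=> xy yz; elim: yz xy => // a b c _ IH Ac bc /IH xb.
exact: sc_step xb Ac bc.
Qed.

Lemma schain_right x y : schain rho A s x y -> A y.
Proof. by case. Qed.

Hypothesis rho_sym : forall x y, rho x y = rho y x.

Lemma schain_sym x y : schain rho A s x y -> schain rho A s y x.
Proof.
elim=> [a Aa|a b c ab ba Ac bc]; first exact: sc_refl.
apply: schain_trans ba; apply: (sc_step _ _ _ _ c); first exact: sc_refl.
  exact: schain_right ab.
by rewrite rho_sym.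
Qed.

End Chains.

(** * Embedded cubes bound the control of a cover *)

Lemma cube_dim_bound (X : Type) (rho : X -> X -> R) (n M D : nat) (s : R)
    (Us : nat -> X -> Prop) (phi : {ffun 'I_M -> bool} -> X) :
  (forall x y, rho x y = rho y x) ->
  (forall x, exists i, (i <= n)%coq_nat /\ Us i x) ->
  (forall v i j, rho (phi (flip v i)) (phi (flip v j)) < s) ->
  (forall i v w, (i <= n)%coq_nat -> schain rho (Us i) s (phi v) (phi w) ->
     (hamming v w <= D)%N) ->
  (M <= D + n.+1 * D.+1)%N.
Proof.
move=> rho_sym cover step diam.
have [c hc] : exists c : {ffun 'I_M -> bool} -> 'I_n.+1,
    forall v, Us (c v) (phi v).
  apply: (choice (fun v (i : 'I_n.+1) => Us i (phi v))) => v.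
  have [i [/leP lin Ui]] := cover (phi v).
  by exists (Ordinal (lin : (i < n.+1)%N)).
have c_le v : (c v <= n)%coq_nat by apply/leP; rewrite -ltnS.
(* Classes are the [s]-components within one colour. Each gets one representative as centre, at
   Hamming distance at most [D]; two flips of [v] with equal colour are [s]-close, hence share
   it. *)
pose same v w := c v = c w /\ schain rho (Us (c v)) s (phi v) (phi w).
have same_refl v : same v v by split=> //; apply: sc_refl.
(* Equality of predicates, not just equivalence, makes [epsilon] pick the same representative for
   the whole class. *)
have same_eq v w : same v w -> same v = same w.
  move=> [cvw vw]; apply: functional_extensionality => u.
  apply: propositional_extensionality; split=> [[cu vu]|[cu wu]].
    split; first by rewrite -cvw.
    rewrite -cvw; apply: schain_trans vu; exact: schain_sym.
  split; first by rewrite cvw.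
  by apply: schain_trans vw _; rewrite cvw.
pose ctr v := epsilon (inhabits v) (same v).
have ctrP v : same v (ctr v) by apply: epsilon_spec; exists v.
apply: (@cube_colouring_bound M n D c ctr) => [v|v i j cij].
  by have [_ /diam] := ctrP v; apply.
have sij : same (flip v i) (flip v j).
  split=> //; apply: sc_step (step v i j); first exact: sc_refl.
  by rewrite cij.
rewrite /ctr (same_eq _ _ sij).
by congr epsilon; apply: proof_irrelevance.
Qed.

(** * The wreath product *)

Section Wreath.

Variables (G H : Group).

Lemma wreath_ext (a b : wreath H G) :
  (forall x, proj1_sig a.1 x = proj1_sig b.1 x) -> a.2 = b.2 -> a = b.
Proof.
case: a b => [[f Hf] g] [[f' Hf'] g'] /= ff' gg'; subst g'.
have E : f = f' by apply: functional_extensionality.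
by subst f'; rewrite (proof_irrelevance _ Hf Hf').
Qed.

Lemma ginvM (x y : G) : ginv G (gmul G x y) = gmul G (ginv G y) (ginv G x).
Proof.
have E : gmul G (gmul G x y) (gmul G (ginv G y) (ginv G x)) = gone G.
  by rewrite gassoc -(gassoc G x y) gmulVr gmul1r gmulVr.
by rewrite -[LHS]gmul1r -E gassoc gmulVl gmul1l.
Qed.

Lemma wmulA (a b c : wreath H G) :
  wmul H G a (wmul H G b c) = wmul H G (wmul H G a b) c.
Proof.
case: a b c => [[f Hf] g] [[f' Hf'] g'] [[f2 Hf2] g2].
apply: wreath_ext => /= [x|]; last exact: gassoc.
by rewrite ginvM !gassoc.
Qed.

Lemma fsupp_one : fsupp G H (fun _ => gone H).
Proof. by exists nil. Qed.

Definition wbase (g : G) : wreath H G := (exist _ _ fsupp_one, g).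

Lemma wbaseM g g' : wmul H G (wbase g) (wbase g') = wbase (gmul G g g').
Proof. by apply: wreath_ext => //= x; rewrite gmul1l. Qed.

Lemma wmul1 (a : wreath H G) : wmul H G a (wbase (gone G)) = a.
Proof.
by case: a => [[f Hf] g]; apply: wreath_ext => /= [x|]; rewrite gmul1r.
Qed.

Variable h : H.

(** Equality in [G] need not be decidable, so the lamps are set classically. *)
Definition lamp (P : G -> Prop) (x : G) : H :=
  if excluded_middle_informative (P x) then h else gone H.

Lemma lamp_fsupp (P : G -> Prop) (l : list G) :
  (forall x, P x -> In x l) -> fsupp G H (lamp P).
Proof.
move=> Pl; exists l => x xl; rewrite /lamp.
by case: excluded_middle_informative => // Px; case: xl; apply: Pl.
Qed.

Lemma delta_fsupp : fsupp G H (lamp (fun x => x = gone G)).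
Proof. by apply: (lamp_fsupp _ (gone G :: nil)) => x ->; left. Qed.

Definition wdelta : wreath H G := (exist _ _ delta_fsupp, gone G).

Variables (M : nat) (p : 'I_M -> G).

Definition lit (v : {ffun 'I_M -> bool}) (x : G) : Prop :=
  exists2 i, v i & p i = x.

Lemma lit_fsupp v : fsupp G H (lamp (lit v)).
Proof.
apply: (lamp_fsupp _ (List.map p (enum 'I_M))) => x [i _ <-].
apply: in_map; have := mem_enum 'I_M i; rewrite inE.
elim: (enum _) => //= j s IH; rewrite inE => /orP[/eqP->|/IH]; auto.
Qed.

Definition wcube (v : {ffun 'I_M -> bool}) : wreath H G :=
  (exist _ _ (lit_fsupp v), gone G).

Hypothesis p_inj : injective p.

Lemma lit_inj (v : {ffun 'I_M -> bool}) i : lit v (p i) <-> v i.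
Proof. by split=> [[j vj /p_inj <-]|vi] //; exists i. Qed.

(** Right multiplication by [wdelta] multiplies the lamp under the cursor by [h]. The lamp must be
    off beforehand, since h^2 need not be 1. *)
Lemma wcube_flip (v : {ffun 'I_M -> bool}) i : v i = false ->
  wmul H G (wcube (flip v i)) (wbase (p i)) =
  wmul H G (wmul H G (wcube v) (wbase (p i))) wdelta.
Proof.
move=> vi; apply: wreath_ext => /= [x|]; last by rewrite !gmul1r.
rewrite !gmul1r gmul1l /lamp.
have xp : gmul G (ginv G (p i)) x = gone G <-> x = p i.
  split=> [E|->]; last exact: gmulVl.
  by rewrite -(gmul1l G x) -(gmulVr G (p i)) -gassoc E gmul1r.
have fl : lit (flip v i) x <-> lit v x \/ x = p i.
  split=> [[j]|[[j vj <-]|->]].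
  - rewrite ffunE; case: eqP => [-> _ <-|_ /= vj <-]; first by right.
    by left; exists j.
  - by exists j; rewrite // ffunE; case: eqP vj => // ->; rewrite vi.
  - by exists i; rewrite // ffunE eqxx vi.
have nl : lit v x -> x <> p i by move=> + E; rewrite E lit_inj vi.
by do 3 case: excluded_middle_informative => /=;
  rewrite ?gmul1l ?gmul1r //; tauto.
Qed.

Hypothesis h_neq1 : h <> gone H.

Lemma lamp_lit_neq (v w : {ffun 'I_M -> bool}) i :
  v i <> w i -> lamp (lit v) (p i) <> lamp (lit w) (p i).
Proof.
move: (lit_inj v i) (lit_inj w i); rewrite /lamp /is_true.
do 2 case: excluded_middle_informative => /=; case: (v i); case: (w i) => //;
  intuition congruence.
Qed.

End Wreath.

(** * Upper and lower bounds for distances in the wreath product *)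

Section WreathMetric.

Variables (G H : Group) (gens : list (wreath H G)).

Lemma gens_supp_bound : exists Q : nat, forall a : wreath H G, In a gens ->
  exists l : list G, (length l <= Q)%coq_nat /\
    forall x, ~ In x l -> proj1_sig a.1 x = gone H.
Proof.
elim: gens => [|a s [Q IH]]; first by exists 0%N.
have [l Hl] := proj2_sig a.1.
exists (Nat.max (length l) Q) => b [<-|/IH[l' [Hl' Hb]]].
  by exists l; split=> //; lia.
by exists l'; split=> //; lia.
Qed.

Lemma wmul_supp (a b : wreath H G) (l : list G) :
  (forall x, ~ In x l -> proj1_sig b.1 x = gone H) ->
  forall x, ~ In x (List.map (gmul G a.2) l) ->
    proj1_sig (wmul H G a b).1 x = proj1_sig a.1 x.
Proof.
case: a b => [[f Hf] g] [[f' Hf'] g'] /= Hl x xl.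
rewrite Hl ?gmul1r // => xl'; apply: xl; apply/in_map_iff.
by eexists; split; last exact: xl'; rewrite gassoc gmulVr gmul1l.
Qed.

Lemma path_supp Q (a b : wreath H G) m :
  (forall a, In a gens -> exists l : list G, (length l <= Q)%coq_nat /\
     forall x, ~ In x l -> proj1_sig a.1 x = gone H) ->
  cay_path (wmul H G) gens m a b ->
  exists l : list G, (length l <= m * Q)%coq_nat /\
    forall x, ~ In x l -> proj1_sig a.1 x = proj1_sig b.1 x.
Proof.
move=> HQ; elim=> [c|k c e f t _ [l [Hl IH]] /HQ[l' [Hl' Ht]] ef].
  by exists nil; split=> //=; lia.
have [g ft] : exists g, forall x, ~ In x (List.map (gmul G g) l') ->
    proj1_sig e.1 x = proj1_sig f.1 x.
  (* A step against a generator is a forward step from its other end, so there the cursor of [f]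
     gives the shift. *)
  by case: ef => ->; [exists e.2 | exists f.2] => x xl;
    rewrite (wmul_supp _ _ _ Ht).
exists (l ++ List.map (gmul G g) l')%list; split.
  by rewrite -multE in Hl *; rewrite length_app length_map /=; lia.
move=> x; rewrite in_app_iff => xl.
by rewrite IH ?ft //; tauto.
Qed.

Variable d : wreath H G -> wreath H G -> R.
Hypothesis dP : is_word_metric (wmul H G) gens d.

(** By left invariance each edge of the Cayley graph of [G] costs at most [L], a bound on the
    finitely many lengths of the elements of [T]. [L] does not depend on the radius, which is fixed
    later. *)
Lemma wbase_dist_bound (T : list G) : exists2 L, 0 <= L &
  forall n g, in_ball G T n g ->
    d (wbase G H (gone G)) (wbase G H g) <= L * INR n.
Proof.
set e := wbase G H (gone G).
have [L L0 HL] : exists2 L, 0 <= L & forall t, In t T -> d e (wbase G H t) <= L.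
  elim: T => [|t s [L L0 IH]]; first by exists 0; [lra|].
  have t0 := dist_ge0 _ _ _ _ dP e (wbase G H t).
  by exists (L + d e (wbase G H t)) => [|u [<-|/IH]]; lra.
have move_le g t : In t T -> d (wbase G H g) (wbase G H (gmul G g t)) <= L.
  move/HL; apply: Rle_trans; rewrite -wbaseM -{1}(wmul1 G H (wbase G H g)).
  by apply: (dist_mull _ _ _ (wmulA G H) _ dP).
exists L => // n g [m [/le_INR mn path]].
apply: (Rle_trans _ (L * INR m)); last exact: Rmult_le_compat_l.
rewrite /e; elim: path {mn} => [x|k x y z t _ IH tT yz].
  by rewrite (dist_refl _ _ _ _ dP) /=; lra.
rewrite S_INR.
have := dist_triangle _ _ _ _ dP (wbase G H y) (wbase G H x) (wbase G H z).
suff : d (wbase G H y) (wbase G H z) <= L by lra.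
case: yz => ->; first exact: move_le.
by rewrite (dist_sym _ _ _ _ dP); apply: move_le.
Qed.

(** Walk to [p i], switch, walk back. If lamp [i] is already on, run the route backwards from
    [flip v i]. *)
Lemma wcube_flip_dist (h : H) (M : nat) (p : 'I_M -> G) (B : R)
    (v : {ffun 'I_M -> bool}) (i : 'I_M) :
  injective p ->
  d (wbase G H (gone G)) (wbase G H (p i)) <= B ->
  d (wcube G H h M p v) (wcube G H h M p (flip v i)) <=
    2 * B + d (wbase G H (gone G)) (wdelta G H h).
Proof.
move=> p_inj HB.
have off (w : {ffun 'I_M -> bool}) : w i = false ->
    d (wcube G H h M p w) (wcube G H h M p (flip w i)) <=
    2 * B + d (wbase G H (gone G)) (wdelta G H h).
  move=> wi.
  have le a b : d a (wmul H G a b) <= d (wbase G H (gone G)) b.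
    rewrite -{1}(wmul1 G H a); exact: (dist_mull _ _ _ (wmulA G H) _ dP).
  set a := wcube G H h M p w; set b := wcube G H h M p (flip w i).
  have h1 := le a (wbase G H (p i)).
  have h2 := le (wmul H G a (wbase G H (p i))) (wdelta G H h).
  have h3 := le b (wbase G H (p i)).
  rewrite -(wcube_flip G H h M p p_inj w i wi) -/b in h2.
  have t1 := dist_triangle _ _ _ _ dP (wmul H G a (wbase G H (p i))) a b.
  have t2 := dist_triangle _ _ _ _ dP (wmul H G b (wbase G H (p i)))
               (wmul H G a (wbase G H (p i))) b.
  rewrite (dist_sym _ _ _ _ dP (wmul _ _ b _) b) in t2.
  lra.
case vi: (v i); last exact: off.
rewrite (dist_sym _ _ _ _ dP) -{2}(flipK M i v); apply: off.
by rewrite ffunE eqxx vi.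
Qed.

(** A path of length m changes at most m [Q] lamps, and every differing coordinate is a differing
    lamp. [Q] precedes [M] and [p] because the cubes must grow with [Q] fixed. *)
Lemma hamming_le_dist : exists Q : nat,
  forall (h : H) M (p : 'I_M -> G) v w,
  h <> gone H -> injective p ->
  INR (hamming v w) <= d (wcube G H h M p v) (wcube G H h M p w) * INR Q.
Proof.
have [Q HQ] := gens_supp_bound; exists Q => h M p v w h1 p_inj.
have [m path ->] := dist_path _ _ _ _ dP (wcube G H h M p v)
  (wcube G H h M p w).
rewrite -mult_INR; apply: le_INR.
have [l [Hl lP]] := path_supp Q _ _ m HQ path.
apply: (Nat.le_trans _ (length l)) => //.
apply: (hamming_le_cover _ _ p) => // i vw.
apply: NNPP => /lP /=; exact: lamp_lit_neq.
Qed.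

End WreathMetric.

(** * Ultrametric cones, and exponential growth against polynomial control *)

Theorem theorem3p6 (G H : Group) (T : list G)
  (HT : generates G T) (Hexp : exp_growth G T)
  (Hfin : exists l : list H, forall h : H, In h l)
  (Hnt : exists h : H, h <> gone H)
  (S : list (wreath H G)) (d : wreath H G -> wreath H G -> R)
  (Hd : is_word_metric (wmul H G) S d) :
  all_cones_ultrametric (log1p d) /\ asdimAN_infinite (log1p d).
Proof.
have d_sym := dist_sym _ _ _ _ Hd; have d_ge0 := dist_ge0 _ _ _ _ Hd.
split.
  apply: log1p_cones_ultrametric => // x y z.
  by rewrite (d_sym y z); apply: dist_triangle Hd _ _ _.
move=> n [C [k [C0 cover]]].
have [h h1] := Hnt; have [c [c1 grow]] := Hexp.
have [L L0 base_le] := wbase_dist_bound _ _ _ _ Hd T.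
have [Q ham_le] := hamming_le_dist _ _ _ _ Hd.
set E := d (wbase G H (gone G)) (wdelta G H h) in base_le.
have E0 : 0 <= E by apply: d_ge0.
(* With D <= Q W + 1 and W >= 1, the cube bound D + (n + 1)(D + 1) is at most (n + 2)(Q W + 2) <= F
   W. *)
set F := (INR n + 2) * (INR Q + 2).
have n0 := pos_INR n; have Q0 := pos_INR Q.
have F0 : 0 < F by apply: Rmult_lt_0_compat; lra.
have lnc : 0 < ln c by rewrite -ln_1; apply: ln_increasing; lra.
(* Two flips of one vertex are at most 4 L r + 2 E apart. Adding 2 instead of 1 makes log (1 + d)
   strictly less than the scale [ln y], and makes that scale positive. *)
have [r hr] := linear_dominates_log (ln c) C (Rabs k + ln F) (4 * L) (2 * E + 2)
  lnc C0 ltac:(lra) ltac:(lra).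
have r0 := pos_INR r.
have Lr : 0 <= L * INR r by apply: Rmult_le_pos.
set y := 4 * L * INR r + (2 * E + 2) in hr.
have y2 : 2 <= y by rewrite /y; lra.
have s0 : 0 < ln y by rewrite -ln_1; apply: ln_increasing; lra.
have [Us [Ucov Udiam]] := cover (ln y) s0.
have [l [l_nodup [l_ball l_size]]] := grow r.
pose M := length l; pose p (i : 'I_M) := List.nth i l (gone G).
have p_inj : injective p.
  move=> i j /(proj1 (NoDup_nth l (gone G)) l_nodup) ij.
  by apply: val_inj; apply: ij; apply/ltP; apply: ltn_ord.
have p_ball i : in_ball G T r (p i).
  by apply/l_ball/nth_In/ltP; apply: ltn_ord.
(* Bounds 1 + d on each component at scale [ln y]; it equals y^C e^|k|, polynomial in [r]. The
   absolute value gives W >= 1. *)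
pose W := exp (C * ln y + Rabs k).
have W1 : 1 <= W.
  rewrite /W -exp_0; apply/Rlt_le/exp_increasing.
  by have := Rabs_pos k; have := Rmult_lt_0_compat _ _ C0 s0; lra.
have QW : 0 <= INR Q * W by apply: Rmult_le_pos; lra.
have [D [D1 D2]] : exists D : nat, INR Q * W <= INR D <= INR Q * W + 1.
  have [u1 u2] := archimed (INR Q * W).
  exists (Z.to_nat (up (INR Q * W))).
  rewrite (INR_IZR_INZ (Z.to_nat _)) Z2Nat.id; first by lra.
  by apply: le_IZR; lra.
have /leP/le_INR bound : (M <= D + n.+1 * D.+1)%N.
  apply: (cube_dim_bound _ (log1p d) n M D (ln y) Us (wcube G H h M p)) => //.
  - by move=> a b; rewrite /log1p d_sym.
  - move=> v i j; apply: ln_increasing.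
      have := d_ge0 (wcube G H h M p (flip v i)) (wcube G H h M p (flip v j)).
      lra.
    have hi := wcube_flip_dist _ _ _ _ Hd h _ _ _ v i p_inj
      (base_le r _ (p_ball i)).
    have hj := wcube_flip_dist _ _ _ _ Hd h _ _ _ v j p_inj
      (base_le r _ (p_ball j)).
    have := dist_triangle _ _ _ _ Hd (wcube G H h M p v)
      (wcube G H h M p (flip v i)) (wcube G H h M p (flip v j)).
    rewrite (d_sym _ (wcube G H h M p v)) /y; rewrite -/E in hi hj; lra.
  - move=> i v w i_le /(Udiam i i_le) vw; apply/leP/INR_le.
    apply: Rle_trans (ham_le h M p v w h1 p_inj) _; apply: Rle_trans D1.
    rewrite Rmult_comm; apply: Rmult_le_compat_l => //.
    have d0 := d_ge0 (wcube G H h M p v) (wcube G H h M p w).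
    have := Rle_abs k; rewrite /log1p in vw => k_le.
    apply: Rnot_lt_le => W_lt.
    have : W < 1 + d (wcube G H h M p v) (wcube G H h M p w) by lra.
    by move/ln_increasing; rewrite /W ln_exp => /(_ (exp_pos _)); lra.
(* This is [hr] exponentiated. *)
have FW : F * W < c ^ r.
  rewrite -Rpower_pow; last lra.
  rewrite -[F]exp_ln // /W -exp_plus /Rpower; apply: exp_increasing; lra.
move: bound; rewrite -plusE -multE plus_INR mult_INR !S_INR => bound.
have : (INR n + 2) * (INR D + 1) <= F * W.
  rewrite /F Rmult_assoc; apply: Rmult_le_compat_l; nra.
rewrite -/M in l_size; lra.
Qed.
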